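(* Let $G=(V,A)$ be a flow graph with start vertex $s$ and dominator tree $D$, and let $T$ be a rooted tree whose vertex set is a subset of $V$. Then $T$ has both the parent property and the sibling property if and only if $T=D$.
   Context: A flow graph is a finite directed graph $G=(V,A)$ with a designated start vertex $s$ such that every vertex is reachable from $s$; throughout, there are no arcs entering $s$ and $|V|>1$. A vertex $v$ dominates $w$ if every path from $s$ to $w$ contains $v$. The dominator tree $D$ is the tree rooted at $s$ on $V$ in which $v$ is an ancestor of $w$ iff $v$ dominates $w$. For a rooted tree $T$, $t(v)$ denotes the parent of $v$; ancestors include the vertex itself. $T$ has the parent property if for every arc $(v,w)\in A$, $t(w)$ is an ancestor of $v$ in $T$. $T$ has the sibling property if for all siblings $v,w$ in $T$, $v$ does not dominate $w$. *)

(* Defs.v *)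
From mathcomp Require Import all_boot.

Set Implicit Arguments.
Unset Strict Implicit.
Unset Printing Implicit Defensive.

Record flow_graph (V : finType) := FlowGraph {
  arc : rel V;
  start : V;
  start_reaches : forall v, connect arc start v;
  no_arc_to_start : forall v, ~~ arc v start;
  several_vertices : 1 < #|V|
}.

Definition dominates (V : finType) (G : flow_graph V) (v w : V) : Prop :=
  forall p : seq V, path (arc G) (start G) p -> last (start G) p = w ->
    v \in start G :: p.

(* A rooted tree is given by its vertex set S, its root r and its parent map t.
   The parent map is [None] at the root and outside S, so that Leibniz equality
   on [rooted_tree] is equality of rooted trees. Since the root is reached from
   every vertex by iterating the parent map, there are no cycles. *)
Definition rooted_tree_axiom (V : finType)
    (S : {set V}) (r : V) (t : {ffun V -> option V}) : bool :=
  [&& r \in S,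
      [forall x, (t x == None) == ((x \notin S) || (x == r))],
      [forall x, forall y, (t x == Some y) ==> (y \in S)] &
      [forall x in S, connect (fun u v => t u == Some v) x r]].

Record rooted_tree (V : finType) := RootedTree {
  vertices : {set V};
  tree_root : V;
  parent : {ffun V -> option V};
  rooted_treeP : rooted_tree_axiom vertices tree_root parent
}.

Definition ancestor (V : finType) (T : rooted_tree V) (v w : V) : bool :=
  [&& v \in vertices T, w \in vertices T &
      connect (fun x y => parent T x == Some y) w v].

Definition siblings (V : finType) (T : rooted_tree V) (v w : V) : Prop :=
  v <> w /\ exists u, parent T v = Some u /\ parent T w = Some u.

Definition dominator_tree (V : finType) (G : flow_graph V)
    (D : rooted_tree V) : Prop :=
  [/\ vertices D = [set: V],
      tree_root D = start G &
      forall v w, ancestor D v w <-> dominates G v w].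

(* For every arc (v,w), both ends must be vertices of T and w must have a
   parent, i.e. must not be the root: otherwise t(w) would be undefined. *)
Definition parent_property (V : finType) (G : flow_graph V)
    (T : rooted_tree V) : Prop :=
  forall v w, arc G v w -> exists2 u, parent T w = Some u & ancestor T u v.

Definition sibling_property (V : finType) (G : flow_graph V)
    (T : rooted_tree V) : Prop :=
  forall v w, siblings T v w -> ~ dominates G v w.

Section DominatorTreeExists.

Variables (V : finType) (G : flow_graph V).
Local Notation s := (start G).

Let avoid (v : V) : rel V := fun x y => arc G x y && (y != v).
Let domb (v w : V) : bool := (v == s) || ~~ connect (avoid v) s w.

Lemma path_avoid v x p :
  path (avoid v) x p = path (arc G) x p && (v \notin p).
Proof.
elim: p x => //= y p IH x; rewrite IH /avoid inE negb_or (eq_sym v y).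
by case: arc => //=; case: (y != v) => //=; rewrite andbF.
Qed.

Lemma dominatesP v w : reflect (dominates G v w) (domb v w).
Proof.
rewrite /domb; apply: (iffP idP) => [|dom].
- case/orP=> [/eqP-> p _ _|nc p ep lp]; first by rewrite inE eqxx.
  apply/negPn/negP; rewrite inE negb_or => /andP[_ vp].
  case/negP: nc; apply/connectP; exists p => //.
  by rewrite path_avoid ep.
- have [//|nvs] := eqVneq v s; apply/negP => /connectP[p].
  rewrite path_avoid => /andP[ep vp] lp.
  by have := dom p ep (esym lp); rewrite inE (negPf nvs) (negPf vp).
Qed.

Lemma simple_path w :
  exists p, [/\ path (arc G) s p, last s p = w & uniq (s :: p)].
Proof.
have /connectP[p ep ->] := start_reaches G w.
by case/shortenP: ep => p' ep' up' _; exists p'.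
Qed.

Lemma dominates_refl v : dominates G v v.
Proof. by move=> p _ <-; apply: mem_last. Qed.

Lemma dominates_start v : dominates G s v.
Proof. by move=> p _ _; rewrite inE eqxx. Qed.

Lemma dominates_trans u v w :
  dominates G u v -> dominates G v w -> dominates G u w.
Proof.
move=> uv vw p ep lp; have vp := vw p ep lp.
case/splitPl: vp ep lp => p1 p2 lv; rewrite cat_path => /andP[ep1 _] _.
by have := uv p1 ep1 lv; rewrite !inE mem_cat => /orP[->//|->]; rewrite orbT.
Qed.

Lemma dominates_anti u v : dominates G u v -> dominates G v u -> u = v.
Proof.
move=> uv vu; have [p [ep lp up]] := simple_path v.
have up1 := uv p ep lp.
case/splitPl: up1 ep lp up => p1 p2 lu; rewrite cat_path last_cat lu.
move=> /andP[ep1 _] lv; rewrite -cat_cons cat_uniq => /and3P[_ /hasPn nh _].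
have vp1 := vu p1 ep1 lu.
case: p2 lv nh => [//|y p2] lv nh.
have := nh v; rewrite vp1 -lv /= mem_last => /(_ isT).
by [].
Qed.

Lemma dominates_chain u v w : dominates G u w -> dominates G v w ->
  dominates G u v \/ dominates G v u.
Proof.
move=> uw vw; have [p [ep lp up]] := simple_path w.
have main a b p1 p2 : dominates G a w -> path (arc G) s (p1 ++ p2) ->
    last s (p1 ++ p2) = w -> last s p1 = b -> a \notin p2 -> dominates G a b.
  move=> aw; rewrite cat_path last_cat => /andP[_ ep2] lw lb ap2 q eq lq.
  have := aw (q ++ p2); rewrite cat_path last_cat eq lq -lb ep2 -lw.
  by move=> /(_ isT erefl); rewrite !inE mem_cat (negPf ap2) orbF.
have vp := vw p ep lp; have uinp := uw p ep lp.
case/splitPl: vp ep lp up uinp => p1 p2 lv ep lp up.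
rewrite -cat_cons mem_cat => /orP[u1|u2].
- left; apply: (main u v p1 p2) => //.
  move: up; rewrite -cat_cons cat_uniq => /and3P[_ /hasPn nh _].
  by apply/negP => /nh; rewrite /= u1.
- right; case/path.splitP: u2 ep lp up => q1 q2 ep lp up.
  apply: (main v u (p1 ++ rcons q1 u) q2) => //; rewrite -?catA //.
    by rewrite last_cat last_rcons.
  move: up; rewrite -cat_cons cat_uniq => /and3P[_ /hasPn nh _].
  apply/negP => vq2; have := nh v; rewrite mem_cat vq2 orbT => /(_ isT).
  by rewrite /= -lv mem_last.
Qed.

Let depth (w : V) := #|[set x | domb x w]|.

Lemma depth_lt u v : dominates G u v -> u != v -> depth u < depth v.
Proof.
move=> uv nuv; apply: proper_card; apply/properP; split.
  apply/subsetP => x; rewrite !inE => /dominatesP xu.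
  by apply/dominatesP; apply: dominates_trans uv.
exists v; rewrite inE; first exact/dominatesP/dominates_refl.
apply/negP => /dominatesP vu.
by rewrite (dominates_anti uv vu) eqxx in nuv.
Qed.

Lemma immediate_dominator w : exists o : option V,
  if w == s then o = None else
  exists u, [/\ o = Some u, dominates G u w, u != w &
    forall v, dominates G v w -> v != w -> dominates G v u].
Proof.
have [_|nws] := eqVneq w s; first by exists None.
have s_ok : domb s w && (s != w).
  by rewrite eq_sym nws andbT; apply/dominatesP/dominates_start.
case: (@arg_maxnP V s (fun u => domb u w && (u != w)) depth s_ok)
  => u /andP[/dominatesP uw nuw] umax.
exists (Some u); exists u; split=> // v vw nvw.
case: (dominates_chain vw uw) => // uv.
have [->|nuv] := eqVneq u v; first exact: dominates_refl.
have /umax: domb v w && (v != w) by rewrite nvw andbT; apply/dominatesP.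
by rewrite /= leqNgt depth_lt.
Qed.

Lemma dominator_tree_exists : exists D, dominator_tree G D.
Proof.
have [f fP] := fin_all_exists immediate_dominator.
pose t := [ffun x => f x].
have tP x u : t x = Some u -> [/\ dominates G u x, u != x &
    forall v, dominates G v x -> v != x -> dominates G v u].
  rewrite ffunE => fx; have := fP x; case: eqP => [_|_ [u' []]].
    by rewrite fx.
  by rewrite fx => -[->].
have tN x : (t x == None) = (x == s).
  rewrite ffunE; have := fP x; case: eqP => [_ ->|_ [u [-> _ _ _]]] //.
have up v w : dominates G v w -> connect (fun x y => t x == Some y) w v.
  have [n] := ubnP (depth w); elim: n w => // n IH w dw vw.
  have [->|nvw] := eqVneq v w; first exact: connect0.
  case tw: (t w) => [u|].
    have [uw nuw umax] := tP _ _ tw.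
    apply: (connect_trans (connect1 _)); first by rewrite tw.
    apply: IH; last exact: umax.
    by apply: leq_trans (depth_lt uw nuw) _; rewrite -ltnS.
  move/eqP: tw; rewrite tN => /eqP ws; case/negP: nvw; apply/eqP.
  by apply: dominates_anti vw _; rewrite ws; apply: dominates_start.
have down v w : connect (fun x y => t x == Some y) w v -> dominates G v w.
  case/connectP=> p ep ->; elim: p w ep => [|y p IH] w /=.
    by move=> _; apply: dominates_refl.
  move=> /andP[/eqP /tP[yw _ _] /IH]; move/dominates_trans; exact.
have wf : rooted_tree_axiom [set: V] s t.
  apply/and4P; split; first by rewrite inE.
  - by apply/forallP => x; rewrite tN in_setT.
  - by apply/forallP => x; apply/forallP => y; rewrite in_setT implybT.
  - by apply/forall_inP => x _; apply/up/dominates_start.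
exists (RootedTree wf); split=> // v w; rewrite /ancestor /= !in_setT /=.
by split; [apply: down | apply: up].
Qed.

End DominatorTreeExists.

(* Main.v *)
From mathcomp Require Import all_boot.
Require Import Defs.

(** The parent property alone makes every tree ancestor a dominator: walking
    backwards along a path from [s] to [w], an ancestor of the current vertex
    stays an ancestor until it is met. For the converse, suppose that [v]
    dominates [w]. If the paths of [T] from the root to [v] and to [w] branched
    below a common ancestor, they would do so at two siblings, both dominating
    [w]; dominators of [w] form a chain, so one sibling would dominate the
    other. Hence the parent and sibling properties force ancestry in [T] to be
    dominance, and dominance determines the parent map: the parent of [w] is
    the closest dominator of [w] other than [w]. *)

Set Implicit Arguments.
Unset Strict Implicit.
Unset Printing Implicit Defensive.

Lemma parent_eq_None (V : finType) (T : rooted_tree V) x :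
  (parent T x == None) = (x \notin vertices T) || (x == tree_root T).
Proof. by case/and4P: (rooted_treeP T) => _ /forallP/(_ x)/eqP. Qed.

Lemma connect_root (V : finType) (T : rooted_tree V) x :
  x \in vertices T ->
  connect (fun u v => parent T u == Some v) x (tree_root T).
Proof. by case/and4P: (rooted_treeP T) => _ _ _ /forall_inP; apply. Qed.

Lemma parent_vertices (V : finType) (T : rooted_tree V) x u :
  parent T x = Some u -> (x \in vertices T) && (u \in vertices T).
Proof.
move=> xu; apply/andP; split.
  have := parent_eq_None T x; rewrite xu => /esym/negbT.
  by rewrite negb_or negbK => /andP[].
case/and4P: (rooted_treeP T) => _ _ /forallP/(_ x)/forallP/(_ u)/implyP.
by rewrite xu eqxx => /(_ isT).
Qed.

(** Iterating the parent map from a fixed point never leaves it, so it would be the root, which has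
    no parent. *)
Lemma parent_neq (V : finType) (T : rooted_tree V) x u :
  parent T x = Some u -> u != x.
Proof.
move=> xu; apply/eqP => ux; rewrite {u}ux in xu.
have /andP[xT _] := parent_vertices xu.
have xr : x = tree_root T.
  case/connectP: (connect_root xT) => p ep ->.
  elim: p ep => //= y p IH; rewrite xu => /andP[/eqP[<-]]; exact: IH.
have := parent_eq_None T x.
by rewrite xu xr eqxx orbT.
Qed.

Lemma ancestor_refl (V : finType) (T : rooted_tree V) x :
  x \in vertices T -> ancestor T x x.
Proof. by move=> xT; rewrite /ancestor xT connect0. Qed.

Lemma ancestor_parent (V : finType) (T : rooted_tree V) x u :
  parent T x = Some u -> ancestor T u x.
Proof.
move=> xu; have /andP[xT uT] := parent_vertices xu.
by rewrite /ancestor xT uT connect1 // xu.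
Qed.

Lemma ancestor_trans (V : finType) (T : rooted_tree V) u v w :
  ancestor T u v -> ancestor T v w -> ancestor T u w.
Proof.
case/and3P=> uT _ vu /and3P[_ wT wv].
by rewrite /ancestor uT wT (connect_trans wv vu).
Qed.

Lemma ancestor_of_parent (V : finType) (T : rooted_tree V) v w u :
  ancestor T v w -> v != w -> parent T w = Some u -> ancestor T v u.
Proof.
case/and3P=> vT _ /connectP[[|y p] /= ep lv] nvw wu.
  by rewrite lv eqxx in nvw.
move: ep; rewrite wu => /andP[/eqP[uy] ep].
have /andP[_ uT] := parent_vertices wu.
by rewrite /ancestor vT uT; apply/connectP; exists p; rewrite uy.
Qed.

Lemma ancestor_child (V : finType) (T : rooted_tree V) z w :
  ancestor T z w -> z != w ->
  exists2 x, parent T x = Some z & ancestor T x w.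
Proof.
case/and3P=> zT wT /connectP[p]; case/lastP: p => [|p y] /=.
  by move=> _ ->; rewrite eqxx.
rewrite rcons_path last_rcons => /andP[ep /eqP lp] zy _.
exists (last w p); first by rewrite zy.
have /andP[lT _] := parent_vertices lp.
by rewrite /ancestor lT wT; apply/connectP; exists p.
Qed.

Lemma rooted_tree_eq (V : finType) (T U : rooted_tree V) :
  vertices T = vertices U -> tree_root T = tree_root U ->
  parent T = parent U -> T = U.
Proof.
case: T U => [S r t Tt] [S' r' t' Tt'] /= eS er et; subst S' r' t'.
(* The axiom is a boolean, so its proof carries no information. *)
by rewrite (bool_irrelevance Tt Tt').
Qed.

Lemma nonstart_has_arc_in (V : finType) (G : flow_graph V) w :
  w != start G -> exists v, arc G v w.
Proof.
move=> nws; have /connectP[p] := start_reaches G w.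
case/lastP: p => [|p y] /=; first by move=> _ ws; rewrite ws eqxx in nws.
rewrite rcons_path last_rcons => /andP[_ a] ->.
by exists (last (start G) p).
Qed.

Lemma start_has_arc_out (V : finType) (G : flow_graph V) :
  exists w, arc G (start G) w.
Proof.
have /card_gt1P[x [y [_ _ nxy]]] := several_vertices G.
have [w nws] : exists w, w != start G.
  by have [xs|] := eqVneq x (start G); [exists y; rewrite -xs eq_sym | exists x].
have /connectP[[|y' p] /=] := start_reaches G w.
  by move=> _ ws; rewrite ws eqxx in nws.
by case/andP=> a _ _; exists y'.
Qed.

(** Every vertex other than [start G] has an entering arc, hence a parent in [T], so it cannot be
    the root. The start itself lies in [T] as the tail of some arc. *)
Lemma parent_property_span (V : finType) (G : flow_graph V) T :
  parent_property G T ->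
  vertices T = [set: V] /\ tree_root T = start G.
Proof.
move=> pT.
have nonstart w : w != start G -> exists u, parent T w = Some u.
  by case/nonstart_has_arc_in => v /pT[u]; exists u.
split; last first.
  apply/eqP/negPn/negP => /nonstart[u ru].
  by have := parent_eq_None T (tree_root T); rewrite ru eqxx orbT.
apply/setP => w; rewrite in_setT.
have [->|/nonstart[u /parent_vertices/andP[]//]] := eqVneq w (start G).
by have [y /pT[u _ /and3P[]]] := start_has_arc_out G.
Qed.

Lemma parent_property_dominates (V : finType) (G : flow_graph V) T v w :
  parent_property G T -> ancestor T v w -> dominates G v w.
Proof.
move=> pT vw p; elim/last_ind: p w vw => [|p y IH] w vw.
  (* On the empty path [w] is the root, whose only ancestor is itself. *)
  move=> _ /= ws; have [vT rr] := parent_property_span pT.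
  have [->|nvw] := eqVneq v w; first by rewrite ws inE.
  case/and3P: vw => _ _ /connectP[[|x q] /= eq lv].
    by rewrite lv eqxx in nvw.
  have := parent_eq_None T w; rewrite rr ws eqxx orbT => /eqP wN.
  by rewrite wN in eq.
rewrite rcons_path last_rcons => /andP[ep a] yw; rewrite {y}yw in a *.
rewrite -rcons_cons mem_rcons inE.
have [//|nvw] := eqVneq v w; have [u wu ua] := pT _ _ a.
by apply: IH ep erefl; apply: ancestor_trans (ancestor_of_parent vw nvw wu) ua.
Qed.

Lemma dominates_ancestor (V : finType) (G : flow_graph V) T v w :
  parent_property G T -> sibling_property G T ->
  dominates G v w -> ancestor T v w.
Proof.
move=> pT sT vw; have [VT rT] := parent_property_span pT.
have inT x : x \in vertices T by rewrite VT in_setT.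
have /connectP[p ep lr] := connect_root (inT v).
have : ancestor T (last v p) w by rewrite -lr /ancestor !inT connect_root.
(* Descend from the root towards [v] as long as the current vertex remains an
   ancestor of [w]. *)
elim/last_ind: p ep {lr} => [//|p z IH].
rewrite rcons_path last_rcons => /andP[ep /eqP yz] zw.
have yv : ancestor T (last v p) v.
  by rewrite /ancestor !inT; apply/connectP; exists p.
have [zw'|nzw] := eqVneq z w.
  have wv : ancestor T w v.
    by rewrite -zw'; apply: ancestor_trans (ancestor_parent yz) yv.
  rewrite (dominates_anti vw (parent_property_dominates pT wv)).
  exact: ancestor_refl.
(* [x] and [last v p] are the children of [z] towards [w] and towards [v]. Both dominate [w], so one
   dominates the other, and the sibling property forces them to coincide. *)
have [x xz xw] := ancestor_child zw nzw.
have [xy|nxy] := eqVneq x (last v p); first by apply: IH; rewrite -?xy.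
have yw := dominates_trans (parent_property_dominates pT yv) vw.
case: (dominates_chain (parent_property_dominates pT xw) yw) => d.
  by case: (sT _ _ _ d); split; [apply/eqP | exists z].
by case: (sT _ _ _ d); split; [apply/eqP; rewrite eq_sym | exists z].
Qed.

Lemma dominator_tree_parent (V : finType) (G : flow_graph V) D w u :
  dominator_tree G D -> parent D w = Some u ->
  dominates G u w /\ (forall v, dominates G v w -> v != w -> dominates G v u).
Proof.
move=> [_ _ domD] wu; split; first exact/domD/ancestor_parent.
by move=> v /domD vw nvw; apply/domD; apply: ancestor_of_parent wu.
Qed.

Lemma dominator_tree_unique (V : finType) (G : flow_graph V) T D :
  dominator_tree G T -> dominator_tree G D -> T = D.
Proof.
move=> hT hD; have [VT rT _] := hT; have [VD rD _] := hD.
apply: rooted_tree_eq; rewrite ?VT ?rT //; apply/ffunP => w.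
have := parent_eq_None D w; have := parent_eq_None T w.
(* Both parent maps are [None] at exactly the same vertices. Elsewhere, the two parents of [w]
   dominate each other. *)
rewrite VT VD rT rD => <-.
case Tw: (parent T w) => [u|]; case Dw: (parent D w) => [u'|] //= _.
have [uw ucl] := dominator_tree_parent hT Tw.
have [u'w u'cl] := dominator_tree_parent hD Dw.
have nuw := parent_neq Tw; have nu'w := parent_neq Dw.
by congr Some; apply: dominates_anti; [apply: u'cl | apply: ucl].
Qed.

Lemma dominator_tree_parent_property (V : finType) (G : flow_graph V) D :
  dominator_tree G D -> parent_property G D.
Proof.
move=> hD v w a; have [VD rD domD] := hD.
have := parent_eq_None D w; rewrite VD in_setT rD /=.
have [ws|_] := eqVneq w (start G).
  by have := no_arc_to_start G v; rewrite -ws a.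
case Dw: (parent D w) => [u|] // _; exists u => //.
(* Extending a path to [v] by the arc gives a path to [w], which contains [u]; as [u] differs from
   [w], it already lies on the path to [v]. *)
apply/domD => p ep lp; have [uw _] := dominator_tree_parent hD Dw.
have := uw (rcons p w); rewrite rcons_path ep lp a last_rcons.
move=> /(_ isT erefl); rewrite -rcons_cons mem_rcons in_cons.
by rewrite (negPf (parent_neq Dw)).
Qed.

(** A vertex dominating its sibling would dominate their common parent, which dominates it in turn;
    by antisymmetry it would be its own parent. *)
Lemma dominator_tree_sibling_property (V : finType) (G : flow_graph V) D :
  dominator_tree G D -> sibling_property G D.
Proof.
move=> hD v w [/eqP nvw [u [vu wu]]] vw.
have [_ ucl] := dominator_tree_parent hD wu.
have [uv _] := dominator_tree_parent hD vu.
have := parent_neq vu.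
by rewrite (dominates_anti uv (ucl _ vw nvw)) eqxx.
Qed.

Theorem theorem5 (V : finType) (G : flow_graph V) (D : rooted_tree V)
    (hD : dominator_tree G D) (T : rooted_tree V) :
  (parent_property G T /\ sibling_property G T) <-> T = D.
Proof.
split=> [[pT sT]|->]; last first.
  split; [exact: dominator_tree_parent_property |
          exact: dominator_tree_sibling_property].
apply: dominator_tree_unique hD; have [VT rT] := parent_property_span pT.
split=> // v w; split; first exact: parent_property_dominates.
exact: dominates_ancestor.
Qed.
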